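(* Let $k\ge 3$ be an integer and let $G$ be a graph (without loops, multiple edges allowed) with $|E(G)|$ divisible by $k$ and maximum degree $\Delta(G)\le 2k-1$. Then $G$ admits a $k$-star-decomposition if and only if $G$ has an independent set $S$ with $|S| = |V(G)|-\frac{1}{k}|E(G)|$ such that for every $A\subseteq V(G)\setminus S$, $$e_G(A)\le \sum_{v\in A}(d_G(v)-k).$$
   Context: Graphs have no loops but may have multiple edges. $d_G(v)$ denotes the degree of $v$ in $G$, and for $A\subseteq V(G)$, $e_G(A)$ denotes the number of edges of $G$ with both ends in $A$. A $k$-star-decomposition of $G$ is a partition of $E(G)$ into edge sets each of which forms a star $K_{1,k}$ (one center vertex joined by $k$ edges to $k$ distinct leaves).
   Formalization: A k-star is taken to be k edges sharing a common end, parallel edges permitted, instead of requiring k distinct leaves; with distinct leaves the ''if'' direction fails for two vertices joined by three parallel edges (k = 3). For simple graphs the two notions coincide. *)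

(* Defs.v *)
From mathcomp Require Import all_boot.

Set Implicit Arguments.
Unset Strict Implicit.
Unset Printing Implicit Defensive.

(* Edges form a type of their own, so that several edges may have the same
   ends; loops are excluded because every edge has exactly two ends. *)
Record multigraph := Multigraph {
  vertex : finType;
  edge : finType;
  ends : edge -> {set vertex};
  card_ends : forall e, #|ends e| = 2
}.

Definition simple (G : multigraph) := injective (@ends G).

Definition degree (G : multigraph) (v : vertex G) : nat :=
  #|[set e | v \in ends e]|.

Definition max_degree (G : multigraph) : nat := \max_(v : vertex G) degree v.

Definition edges_within (G : multigraph) (A : {set vertex G}) : nat :=
  #|[set e | ends e \subset A]|.

Definition independent (G : multigraph) (S : {set vertex G}) : Prop :=
  forall e : edge G, ~~ (ends e \subset S).

(* The star K_{1,k}, with k distinct leaves; [leaf e] is the end of [e] other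
   than the center [c]. *)
Definition proper_k_star (k : nat) (G : multigraph) (B : {set edge G}) : Prop :=
  #|B| = k /\
  exists (c : vertex G) (leaf : edge G -> vertex G),
    {in B, forall e, ends e = [set c; leaf e]} /\ {in B &, injective leaf}.

(* A k-star of a multigraph is a set of k edges with a common end, and may use
   parallel edges. In a simple graph this is exactly K_{1,k}: see
   [k_star_simpleP]. Requiring the leaves to be distinct in a multigraph would
   not do for the characterization of graphs with a k-star-decomposition by
   independent sets: two vertices u, v joined by 3 parallel edges satisfy the
   condition for k = 3 with S = {u}, but contain no K_{1,3}. *)
Definition k_star (k : nat) (G : multigraph) (B : {set edge G}) : Prop :=
  #|B| = k /\ exists c : vertex G, {in B, forall e, c \in ends e}.

Definition has_k_star_decomposition (k : nat) (G : multigraph) : Prop :=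
  exists P : {set {set edge G}},
    partition P [set: edge G] /\ {in P, forall B, k_star k B}.

Lemma proper_k_star_k_star (k : nat) (G : multigraph) (B : {set edge G}) :
  proper_k_star k B -> k_star k B.
Proof.
move=> [cardB [c [leaf [endsB _]]]]; split=> //; exists c => e /endsB ->.
exact: set21.
Qed.

Lemma k_star_simpleP (k : nat) (G : multigraph) (B : {set edge G}) :
  simple G -> k_star k B <-> proper_k_star k B.
Proof.
move=> simG; split; last exact: proper_k_star_k_star.
move=> [cardB [c cB]]; split=> //; exists c.
pose leaf (e : edge G) := odflt c [pick v in ends e :\ c].
have endsE : {in B, forall e, ends e = [set c; leaf e]}.
  move=> e /cB ce; have /cards1P[v ev] : #|ends e :\ c| == 1.
    by have := cardsD1 c (ends e); rewrite ce card_ends add1n => -[<-].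
  rewrite /leaf ev; case: pickP => [w|/(_ v)]; last by rewrite inE eqxx.
  by rewrite inE => /eqP ->; rewrite -(setD1K ce) ev.
exists leaf; split=> // e f eB fB eq_leaf; apply: simG.
by rewrite (endsE e eB) (endsE f fB) eq_leaf.
Qed.

(* Main.v *)
(** The bound on the degrees makes every vertex the center of at most one star,
    so the set [S] of the vertices that are not centers has the required size,
    and [S] is independent because every edge meets the center of its star.  By
    double counting, the inequality for [A] says that at least [k * #|A|] edges
    meet [A], which is Hall's condition for assigning [k] edges to each vertex
    outside [S]; as there are [k * #|~: S|] edges, all of them are assigned. *)
Require Import Defs.
From mathcomp Require Import all_boot all_order all_algebra.
From mathcomp Require Import zify.
Import Order.TTheory GRing.Theory Num.Theory.
Local Open Scope ring_scope.

(** * Hall's marriage theorem *)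

Definition hall_condition {X Y : finType} (N : X -> {set Y}) : Prop :=
  forall A : {set X}, (#|A| <= #|\bigcup_(x in A) N x|)%N.

Definition remove_at {X Y : finType} (N : X -> {set Y}) (x : X) (y : Y) :
    X -> {set Y} :=
  fun z => if z == x then N x :\ y else N z.

Lemma bigcup_remove_at {X Y : finType} (N : X -> {set Y}) (x : X) (y : Y)
    (A : {set X}) :
  x \in A ->
  \bigcup_(z in A) remove_at N x y z =
    (N x :\ y) :|: \bigcup_(z in A :\ x) N z.
Proof.
move=> xA; rewrite (big_setD1 x) //= /remove_at eqxx; congr (_ :|: _).
by apply: eq_bigr => z; rewrite !inE => /andP[/negPf ->].
Qed.

Lemma bigcup_remove_at_out {X Y : finType} (N : X -> {set Y}) (x : X) (y : Y)
    (A : {set X}) :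
  x \notin A -> \bigcup_(z in A) remove_at N x y z = \bigcup_(z in A) N z.
Proof.
move=> xA; apply: eq_bigr => z zA; rewrite /remove_at ifN //.
by apply: contraNneq xA => <-.
Qed.

(* Rado's argument: two violating sets [A1] and [A2], one for each removal,
   would contradict submodularity, since the union and the intersection of their
   neighborhoods contain those of [A1 :|: A2] and [(A1 :&: A2) :\ x]. *)
Lemma hall_condition_remove {X Y : finType} (N : X -> {set Y}) (x : X)
    (y1 y2 : Y) :
  hall_condition N -> y1 != y2 ->
  hall_condition (remove_at N x y1) \/
  hall_condition (remove_at N x y2).
Proof.
move=> hallN y12.
pose ok y := [forall A : {set X},
  (#|A| <= #|\bigcup_(z in A) remove_at N x y z|)%N].
have [/forallP ok1|bad1] := boolP (ok y1); first by left.
have [/forallP ok2|bad2] := boolP (ok y2); first by right.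
(* A violating set must contain [x], since the removal does not change the neighborhood of any other
   set. *)
have viol y : ~~ ok y -> exists2 A : {set X}, x \in A &
    (#|(N x :\ y) :|: \bigcup_(z in A :\ x) N z| < #|A|)%N.
  case/forallPn => A; rewrite -ltnNge => ltA.
  have [xA|xA] := boolP (x \in A).
    by exists A => //; rewrite -bigcup_remove_at.
  by move: ltA; rewrite bigcup_remove_at_out // ltnNge hallN.
have [A1 xA1 lt1] := viol _ bad1; have [A2 xA2 lt2] := viol _ bad2.
set U1 := _ :|: _ in lt1; set U2 := _ :|: _ in lt2.
have leU : (#|A1 :|: A2| <= #|U1 :|: U2|)%N.
  apply: leq_trans (hallN _) (subset_leq_card _).
  apply/subsetP => y /bigcupP[z zA yz].
  have [zx|zx] := eqVneq z x.
    (* As [y1 != y2], each element of [N x] survives one of the two removals. *)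
    rewrite zx in yz; rewrite !inE yz !andbT.
    by have [->|//] := eqVneq y y1; rewrite y12 !orbT.
  move: zA; rewrite inE => /orP[zA|zA]; rewrite !inE.
    have -> : y \in \bigcup_(z in A1 :\ x) N z.
      by apply/bigcupP; exists z; rewrite // !inE zx.
    by rewrite orbT.
  have -> : y \in \bigcup_(z in A2 :\ x) N z.
    by apply/bigcupP; exists z; rewrite // !inE zx.
  by rewrite !orbT.
have leI : (#|(A1 :&: A2) :\ x| <= #|U1 :&: U2|)%N.
  apply: leq_trans (hallN _) (subset_leq_card _).
  apply/bigcupsP => z; rewrite !inE => /and3P[zx z1 z2].
  by rewrite subsetI !subsetU // (bigcup_sup z) ?orbT // !inE zx.
(* Only [x] is lost in [leI], so [#|U1| + #|U2|] is at least [#|A1| + #|A2| - 1], whereas the two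
   violations make it at most [#|A1| + #|A2| - 2]. *)
have := cardsUI A1 A2; have := cardsUI U1 U2.
have := cardsD1 x (A1 :&: A2); rewrite inE xA1 xA2 /=; lia.
Qed.

(** Induction on the total size of the neighborhoods: while some [N x] has two elements, one of them
    can be removed. Once all are singletons, Hall's condition for pairs makes the only choice
    injective. *)
Lemma hall_marriage {X Y : finType} (N : X -> {set Y}) :
  hall_condition N ->
  exists f : X -> Y, injective f /\ forall x, f x \in N x.
Proof.
have [n] := ubnP (\sum_x #|N x|)%N; elim: n N => // n IHn N ltn hallN.
have N_gt0 x : (0 < #|N x|)%N.
  by have := hallN [set x]; rewrite big_set1 cards1.
have [/existsP[x /card_gt1P[y1 [y2 [y1N y2N y12]]]]|] :=
    boolP [exists x, (1 < #|N x|)%N].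
  have step y : y \in N x -> hall_condition (remove_at N x y) ->
      exists f : X -> Y, injective f /\ forall x, f x \in N x.
    move=> yN hally; have [|f [injf fN]] := IHn _ _ hally.
      apply: leq_trans (ltn : (_ <= n)%N).
      rewrite (bigD1 x) //= [X in (_ < X)%N](bigD1 x) //=.
      rewrite {1}/remove_at eqxx [X in (_ < X + _)%N](cardsD1 y) yN.
      rewrite add1n ltnS leq_add2l.
      by apply: leq_sum => z /negPf zx; rewrite /remove_at zx.
    exists f; split=> // z; have := fN z; rewrite /remove_at.
    by case: eqP => // ->; rewrite inE => /andP[].
  by have [] := hall_condition_remove _ x _ _ hallN y12; apply: step.
move=> /existsPn N_le1.
have /fin_all_exists[f fN] : forall x, exists y, N x = [set y].
  move=> x; apply/cards1P; rewrite eqn_leq N_gt0 andbT.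
  by rewrite leqNgt N_le1.
exists f; split=> [x1 x2 eqf|x]; last by rewrite fN set11.
apply/eqP/contraT => x12; have := hallN [set x1; x2].
by rewrite big_setU1 ?inE //= big_set1 !fN eqf setUid cards2 x12 cards1.
Qed.

(** * Double counting of incidences *)

Definition edges_meeting {G : multigraph} (A : {set vertex G}) : {set edge G} :=
  [set e | ends e :&: A != set0].

(** An edge with exactly one end in [A] counts once on each side; an edge inside [A] counts twice,
    on the right once in each term. *)
Lemma sum_degree {G : multigraph} (A : {set vertex G}) :
  (\sum_(v in A) degree v = #|edges_meeting A| + edges_within A)%N.
Proof.
have -> : (\sum_(v in A) degree v = \sum_e #|ends e :&: A|)%N.
  rewrite (eq_bigr (fun v => \sum_e (v \in ends e)))%N; last first.
    by move=> v _; rewrite /degree -sum1dep_card big_mkcond.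
  rewrite exchange_big; apply: eq_bigr => e _ /=.
  rewrite -sum1_card big_mkcond [RHS]big_mkcond; apply: eq_bigr => v _.
  by rewrite inE; do 2!case: (v \in _).
rewrite /edges_within -!sum1dep_card [X in (X + _)%N]big_mkcond.
rewrite [X in (_ + X)%N]big_mkcond -big_split /=.
apply: eq_bigr => e _; have [sub|nsub] := boolP (ends e \subset A).
  by rewrite (setIidPl sub) -card_gt0 card_ends.
have := proper_card (_ : ends e :&: A \proper ends e).
rewrite properE subsetIl subsetI subxx (negPf nsub) card_ends -card_gt0.
by move=> /(_ isT); case: #|_| => [|[]].
Qed.

Lemma edges_within_leE (k : nat) (G : multigraph) (A : {set vertex G}) :
  ((edges_within A)%:Z <= \sum_(v in A) ((degree v)%:Z - k%:Z)) =
  (#|A| * k <= #|edges_meeting A|)%N.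
Proof.
rewrite sumrB sumr_const -mulr_natr natz -PoszM.
under eq_bigr do rewrite -natz.
rewrite -natr_sum natz sum_degree.
by apply/idP/idP; lia.
Qed.

(** * Star decompositions and their sets of centers *)

Lemma k_star_decomposition_centers (k : nat) (G : multigraph) :
  (0 < k)%N -> (max_degree G < 2 * k)%N -> has_k_star_decomposition k G ->
  exists C : {set vertex G},
    [/\ #|edge G| = (#|C| * k)%N,
        edges_meeting C = setT
      & forall A : {set vertex G}, A \subset C -> (#|A| * k <= #|edges_meeting A|)%N].
Proof.
move=> k_gt0 max_lt [P [partP starP]].
have trivP : trivIset P by have /and3P[] := partP.
have /fin_all_exists[c cP] : forall B : {B | B \in P},
    exists c : vertex G, {in val B, forall e, c \in ends e}.
  by move=> B; have [_ []] := starP _ (valP B); eauto.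
have cardB (B : {B | B \in P}) : #|val B| = k.
  by have [] := starP _ (valP B).
(* Two disjoint stars with a common center would give it degree at least [2 * k]. *)
have inj_c : injective c.
  move=> B1 B2 eqc; apply/val_inj/eqP/contraT => B12.
  have disj : [disjoint val B1 & val B2].
    by apply: (trivIsetP trivP) => //; apply: valP.
  have : (#|val B1 :|: val B2| <= degree (c B1))%N.
    apply: subset_leq_card; apply/subsetP => e; rewrite !inE => /orP[/cP //|].
    by rewrite eqc => /cP.
  rewrite cardsU (disjoint_setI0 disj) cards0 !cardB.
  have : (degree (c B1) <= max_degree G)%N by exact: leq_bigmax.
  lia.
exists [set c B | B in setT]; split=> [||A subA].
- rewrite card_imset // cardsT card_sig -cardsT.
  by apply: card_uniform_partition partP => B /starP[].
- apply/setP => e; rewrite !inE; apply/set0Pn.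
  have eP : e \in cover P by rewrite (cover_partition partP) inE.
  have [B BP eB] := bigcupP eP.
  exists (c (exist _ B BP)); rewrite inE imset_f ?inE // andbT.
  exact: (cP (exist _ B BP)).
(* The stars centered in [A] are [#|A|] disjoint sets of [k] edges, all of which meet [A]. *)
pose Q := [set val B | B in c @^-1: A].
have QP : Q \subset P by apply/subsetP => _ /imsetP[B _ ->]; apply: valP.
have -> : (#|A| * k = #|cover Q|)%N.
  rewrite -(eqP (trivIsetS QP trivP)) big_imset /=; last by move=> ? ? _ _ /val_inj.
  rewrite (eq_bigr (fun=> k)) => [|B _]; last exact: cardB.
  rewrite sum_nat_const; congr (_ * _)%N.
  rewrite -(card_imset _ inj_c); apply: eq_card => v; apply/idP/imsetP.
    by move=> vA; have /imsetP[B _ ev] := subsetP subA v vA; exists B; rewrite // inE -ev.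
  by case=> B; rewrite inE => cA ->.
apply: subset_leq_card; apply/subsetP => e /bigcupP[_ /imsetP[B cA ->] eB].
rewrite inE in cA; rewrite inE; apply/set0Pn; exists (c B).
by rewrite inE cA andbT cP.
Qed.

(** Hall's theorem is applied to [k] copies of each center, every copy choosing an edge at that
    center. There are as many copies as edges, so the injective choice is a bijection and the edges
    chosen by the copies of one center form a star. *)
Lemma centers_k_star_decomposition (k : nat) (G : multigraph)
    (C : {set vertex G}) :
  (0 < k)%N -> #|edge G| = (#|C| * k)%N ->
  (forall A : {set vertex G}, A \subset C -> (#|A| * k <= #|edges_meeting A|)%N) ->
  has_k_star_decomposition k G.
Proof.
move=> k_gt0 card_edge meetC.
pose X : finType := ({v | v \in C} * 'I_k)%type.
have [f [inj_f fP]] : exists f : X -> edge G, injective f /\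
    forall x, f x \in [set e | val x.1 \in ends e].
  apply: hall_marriage => A; pose B := [set val x.1 | x in A].
  have BC : B \subset C by apply/subsetP => _ /imsetP[x _ ->]; apply: valP.
  (* [A] may contain only some of the copies of a center; [B] forgets the copies and has the same
     neighborhood. *)
  have : (#|A| <= #|B| * k)%N.
    pose h (x : X) := (val x.1, x.2).
    have inj_h : injective h.
      by move=> [x1 x2] [y1 y2] [/val_inj -> ->].
    rewrite -(card_imset _ inj_h) -[X in (_ * X)%N]card_ord -cardsT -cardsX.
    apply: subset_leq_card; apply/subsetP => _ /imsetP[x xA ->].
    by rewrite !inE andbT; apply/imsetP; exists x.
  move=> /leq_trans; apply; apply: leq_trans (meetC _ BC) (subset_leq_card _).
  apply/subsetP => e; rewrite inE => /set0Pn[v]; rewrite inE => /andP[ve].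
  case/imsetP => x xA vx; apply/bigcupP; exists x => //.
  by rewrite inE -vx.
have cardX : #|X| = #|edge G|.
  by rewrite card_prod card_sig card_ord card_edge.
have surj_f e : exists x, e = f x.
  have : e \in f @: setT.
    suff /eqP -> : f @: setT == setT by rewrite inE.
    by rewrite eqEcard subsetT card_imset // !cardsT cardX leqnn.
  by case/imsetP => x _; exists x.
pose star v := [set f (v, i) | i in setT].
have card_star v : #|star v| = k.
  by rewrite card_imset ?cardsT ?card_ord // => i j /inj_f[].
exists [set star v | v in setT]; split; last first.
  move=> _ /imsetP[v _ ->]; split=> //; exists (val v) => _ /imsetP[i _ ->].
  by have := fP (v, i); rewrite inE.
apply/and3P; split.
- apply/eqP/setP => e; rewrite [RHS]inE; have [[v i] ->] := surj_f e.
  by apply/bigcupP; exists (star v); apply: imset_f; rewrite inE.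
- apply/trivIsetP => _ _ /imsetP[v _ ->] /imsetP[w _ ->].
  apply: contraR => /pred0Pn[e /andP[/imsetP[i _ ->] /imsetP[j _ /inj_f[-> _]]]].
  exact: eqxx.
apply/imsetP => -[v _ star0].
by move: k_gt0; rewrite -(card_star v) -star0 cards0.
Qed.

Theorem theorem3p3 (k : nat) (G : multigraph)
    (k_ge3 : (3 <= k)%N)
    (k_dvd_edges : (k %| #|edge G|)%N)
    (max_degree_le : (max_degree G <= 2 * k - 1)%N) :
  has_k_star_decomposition k G <->
  exists S : {set vertex G},
    [/\ independent S,
        #|S|%:Z = #|vertex G|%:Z - (#|edge G| %/ k)%N%:Z
      & forall A : {set vertex G}, A \subset ~: S ->
          (edges_within A)%:Z <= \sum_(v in A) ((degree v)%:Z - k%:Z)].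
Proof.
have k_gt0 : (0 < k)%N by lia.
split=> [decG | [S [_ cardS leS]]].
  have [|C [cardE meetC leC]] := k_star_decomposition_centers _ _ k_gt0 _ decG.
    by lia.
  exists (~: C); split=> [e||A].
  (* An edge that meets [C] is not inside its complement. *)
  - have : e \in edges_meeting C by rewrite meetC.
    by rewrite inE setI_eq0 disjoints_subset.
  - by rewrite cardE mulnK //; have := cardsC C; lia.
  by rewrite setCK edges_within_leE; apply: leC.
apply: (centers_k_star_decomposition k G (~: S)) => // [|A /leS].
  rewrite -{1}(divnK k_dvd_edges); congr (_ * _)%N.
  by have := cardsC S; lia.
by rewrite edges_within_leE.
Qed.
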